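(* Let $\alpha\in\mathbb{N}_0$, $\lambda\in\mathbb{R}$ and $x\in\mathbb{R}$. For every integer $n\ge0$, the degenerate Fubini-type polynomials satisfy $$a_n^{(\alpha)}(x+1;\lambda)=2a_n^{(\alpha)}(x;\lambda)-\sqrt{2}\,a_n^{(\alpha-1/2)}(x;\lambda).$$
   Context: For an order $\beta$ with $2\beta\in\mathbb{Z}$, the degenerate Fubini-type polynomials $a_n^{(\beta)}(x;\lambda)$ are defined by the power series expansion in $t$ near $t=0$ $$\frac{2^{\beta}}{\left(2-(1+\lambda t)^{1/\lambda}\right)^{2\beta}}(1+\lambda t)^{x/\lambda}=\sum_{n=0}^{\infty}a_n^{(\beta)}(x;\lambda)\frac{t^n}{n!},$$ where for $\lambda\neq0$, $(1+\lambda t)^{y/\lambda}$ is the principal power, and for $\lambda=0$ it is understood as its limit $e^{yt}$. *)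

(* Defs.v *)
From Stdlib Require Import Reals Factorial ClassicalEpsilon.
From Coquelicot Require Import Coquelicot.
Open Scope R_scope.

(* The power (1 + lambda t)^(y / lambda), for 1 + lambda t > 0 (in particular
   for t near 0); [Rpower b e] is exp (e * ln b). *)
Definition deg_exp (lambda y t : R) : R :=
  if Req_EM_T lambda 0 then exp (y * t)
  else Rpower (1 + lambda * t) (y / lambda).

Definition is_egf (f : R -> R) (a : nat -> R) : Prop :=
  locally 0 (fun t => is_pseries (fun n => a n / INR (fact n)) t (f t)).

(* For t near 0 the base 2 - deg_exp lambda 1 t is close to 1, hence positive,
   so that the real power below is the integer power when 2 beta is an
   integer, of either sign. *)
Definition fubini_gen (beta lambda x t : R) : R :=
  Rpower 2 beta / Rpower (2 - deg_exp lambda 1 t) (2 * beta)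
  * deg_exp lambda x t.

(* The sequence n |-> a_n^(beta)(x; lambda) is the one whose exponential power
   series represents the generating function on a neighbourhood of 0.  It is
   unique, and it exists since the generating function is analytic at 0. *)
Definition deg_fubini (n : nat) (beta x lambda : R) : R :=
  epsilon (inhabits (fun _ : nat => 0)) (is_egf (fubini_gen beta lambda x)) n.

(* Main.v *)
(** Write E_y for (1 + lambda t)^(y/lambda).  Since E_(x+1) = E_1 E_x and
    E_1 = 2 - (2 - E_1), the generating functions F_(alpha,x) satisfy
    F_(alpha,x+1) = 2 F_(alpha,x) - sqrt 2 F_(alpha-1/2,x), and the theorem follows by
    comparing coefficients.  Because the polynomials are picked by [epsilon], this also needs
    that the generating functions are analytic at 0: E_y is the sum of the binomial series, which
    solves (1 + lambda t) S' = y S, and 1 / (2 - E_1) is handled by inverting power series. *)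
Require Import Defs.
From Stdlib Require Import Reals.
From Coquelicot Require Import Coquelicot.
From Stdlib Require Import Arith Lra Lia ClassicalEpsilon.
Open Scope R_scope.

(** * Neighbourhoods of 0 and radii of convergence *)

Lemma locally_0_intro (P : R -> Prop) (r : R) :
  0 < r -> (forall t, Rabs t < r -> P t) -> locally 0 P.
Proof.
intros Hr H. exists (mkposreal r Hr). intros t Ht. apply H.
change (Rabs (t - 0) < r) in Ht. now rewrite Rminus_0_r in Ht.
Qed.

Lemma locally_0_elim (P : R -> Prop) :
  locally 0 P -> exists r, 0 < r /\ forall t, Rabs t < r -> P t.
Proof.
intros [r H]. exists r. split. apply cond_pos.
intros t Ht. apply H. change (Rabs (t - 0) < r). now rewrite Rminus_0_r.
Qed.

Lemma CV_radius_geometric (a : nat -> R) (M : R) :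
  0 < M -> (forall n, Rabs (a n) <= M ^ n) -> Rbar_le (/ M) (CV_radius a).
Proof.
intros HM H. apply (proj1 (CV_radius_bounded a)). exists 1. intros n.
rewrite Rabs_mult, <- RPow_abs, (Rabs_pos_eq (/ M))
  by (left; now apply Rinv_0_lt_compat).
rewrite pow_inv. apply Rle_trans with (M ^ n * / M ^ n).
- apply Rmult_le_compat_r; [|apply H]. left. apply Rinv_0_lt_compat. now apply pow_lt.
- right. apply Rinv_r. apply pow_nonzero. lra.
Qed.

(** Convergence at [r / 2] makes the terms there tend to 0, which is impossible outside the closed
    disc of convergence. *)
Lemma CV_radius_pos_of_locally (a : nat -> R) (f : R -> R) :
  locally 0 (fun t => is_pseries a t (f t)) -> Rbar_lt 0 (CV_radius a).
Proof.
intros H. destruct (locally_0_elim _ H) as (r & Hr & Hs).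
apply Rbar_lt_le_trans with (r / 2). simpl; lra.
destruct (Rbar_le_lt_dec (r / 2) (CV_radius a)) as [|Hlt]; [assumption|exfalso].
assert (Hab : Rabs (r / 2) = r / 2) by (apply Rabs_pos_eq; lra).
apply (CV_disk_outside a (r / 2)). now rewrite Hab.
apply ex_series_lim_0. exists (f (r / 2)). apply is_pseries_R, Hs. lra.
Qed.

(** * Functions analytic at 0 and their closure properties *)

Definition analytic_at_0 (f : R -> R) : Prop :=
  exists a : nat -> R, locally 0 (fun t => is_pseries a t (f t)).

Lemma analytic_of_pseries (a : nat -> R) (f : R -> R) (r : R) :
  0 < r -> Rbar_le r (CV_radius a) ->
  (forall t, Rabs t < r -> PSeries a t = f t) -> analytic_at_0 f.
Proof.
intros Hr Ha Hf. exists a. apply (locally_0_intro _ r Hr). intros t Ht.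
rewrite <- Hf by exact Ht. apply PSeries_correct, CV_radius_inside.
now apply Rbar_lt_le_trans with r.
Qed.

Lemma analytic_ext (f g : R -> R) :
  locally 0 (fun t => f t = g t) -> analytic_at_0 f -> analytic_at_0 g.
Proof.
intros Heq [a Ha]. exists a. generalize (filter_and _ _ Heq Ha).
apply filter_imp. intros t [E H]. now rewrite <- E.
Qed.

(** The Cauchy product theorem asks for [t] strictly inside both discs of convergence, so the
    neighbourhood is shrunk accordingly. *)
Lemma analytic_mult (f g : R -> R) :
  analytic_at_0 f -> analytic_at_0 g -> analytic_at_0 (fun t => f t * g t).
Proof.
intros [a Ha] [b Hb]. exists (PS_mult a b).
assert (Hra := CV_radius_pos_of_locally a f Ha).
assert (Hrb := CV_radius_pos_of_locally b g Hb).
assert (Hc : forall c, Rbar_lt 0 (CV_radius c) ->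
  locally 0 (fun t => Rbar_lt (Rabs t) (CV_radius c))).
{ intros c Hc. destruct (CV_radius c) as [r| |]; simpl in Hc.
  - now apply (locally_0_intro _ r).
  - apply (locally_0_intro _ 1); [lra|now intros].
  - easy. }
generalize (filter_and _ _ (filter_and _ _ Ha Hb)
  (filter_and _ _ (Hc a Hra) (Hc b Hrb))).
apply filter_imp. intros t [[H1 H2] [H3 H4]]. now apply is_pseries_mult.
Qed.

Lemma PSeries_const_coef (c t : R) :
  PSeries (fun n => match n with O => c | _ => 0 end) t = c.
Proof.
apply is_pseries_unique, is_pseries_R.
apply filterlim_ext with (fun _ : nat => c); [|apply filterlim_const].
intros n. rewrite sum_n_Reals. induction n as [|n IH]; simpl. ring.
rewrite <- IH. ring.
Qed.

Lemma analytic_const (c : R) : analytic_at_0 (fun _ => c).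
Proof.
apply (analytic_of_pseries (fun n => match n with O => c | _ => 0 end) _ 1); [lra| |].
- apply (proj1 (CV_radius_bounded _)). exists (Rabs c). intros n.
  rewrite pow1, Rmult_1_r. destruct n. lra. rewrite Rabs_R0. apply Rabs_pos.
- intros t _. apply PSeries_const_coef.
Qed.

Lemma analytic_plus (f g : R -> R) :
  analytic_at_0 f -> analytic_at_0 g -> analytic_at_0 (fun t => f t + g t).
Proof.
intros [a Ha] [b Hb]. exists (PS_plus a b). generalize (filter_and _ _ Ha Hb).
apply filter_imp. intros t [H1 H2]. exact (is_pseries_plus a b t _ _ H1 H2).
Qed.

Lemma analytic_pow (f : R -> R) (k : nat) :
  analytic_at_0 f -> analytic_at_0 (fun t => f t ^ k).
Proof.
intros Hf. induction k as [|k IH]; simpl. apply analytic_const.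
now apply analytic_mult.
Qed.

(** * Inversion of power series with constant term 1 *)

(* The first argument is fuel, making the course-of-values recursion
   b_(m+1) = - sum_(k <= m) a_(k+1) b_(m-k) structural; it is exact as soon as it is at least [n]. *)
Fixpoint inv_coef_fuel (a : nat -> R) (fuel n : nat) : R :=
  match fuel, n with
  | S f, S m => - sum_f_R0 (fun k => a (S k) * inv_coef_fuel a f (m - k)%nat) m
  | _, _ => 1
  end.

Definition inv_coef (a : nat -> R) (n : nat) : R := inv_coef_fuel a n n.

Lemma inv_coef_fuel_ge (a : nat -> R) (f n : nat) :
  (n <= f)%nat -> inv_coef_fuel a f n = inv_coef a n.
Proof.
revert n. induction f as [f IH] using lt_wf_ind. intros n Hn.
unfold inv_coef. destruct n as [|m]; destruct f as [|f]; try easy.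
cbn [inv_coef_fuel]. f_equal. apply sum_eq. intros k Hk.
(* The two sides carry fuel [f] and [m]; both are at least [m - k]. *)
rewrite (IH f) by lia. rewrite (IH m) by lia. reflexivity.
Qed.

Lemma inv_coef_S (a : nat -> R) (m : nat) :
  inv_coef a (S m) = - sum_f_R0 (fun k => a (S k) * inv_coef a (m - k)%nat) m.
Proof.
unfold inv_coef at 1. cbn [inv_coef_fuel]. f_equal. apply sum_eq. intros k Hk.
now rewrite inv_coef_fuel_ge by lia.
Qed.

Lemma PS_mult_inv_coef (a : nat -> R) (n : nat) :
  a O = 1 -> PS_mult a (inv_coef a) n = match n with O => 1 | _ => 0 end.
Proof.
intros H0. unfold PS_mult. destruct n as [|n].
- simpl. rewrite H0. unfold inv_coef. simpl. ring.
- rewrite decomp_sum by lia. rewrite H0. cbn [Nat.pred Nat.sub].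
  rewrite inv_coef_S. ring.
Qed.

(** A geometric sum of ratio 1/2, since the term at [k] is [(2 * M) ^ S m / 2 ^ S k]. *)
Lemma sum_mixed_powers (M : R) (m : nat) :
  sum_f_R0 (fun k => M ^ S k * (2 * M) ^ (m - k)) m = (2 * M) ^ S m - M ^ S m.
Proof.
induction m as [|m IH]. simpl; ring.
rewrite tech5, Nat.sub_diag.
rewrite (sum_eq _ (fun k => M ^ S k * (2 * M) ^ (m - k) * (2 * M))).
- rewrite <- scal_sum, IH. simpl. ring.
- intros k Hk. rewrite Nat.sub_succ_l by lia. simpl. ring.
Qed.

(** Doubling the growth rate absorbs the convolution: the worst case is the series of (1 - M z) / (1
    - 2 M z). *)
Lemma inv_coef_bound (a : nat -> R) (M : R) :
  0 < M -> (forall n, Rabs (a n) <= M ^ n) ->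
  forall n, Rabs (inv_coef a n) <= (2 * M) ^ n.
Proof.
intros HM Ha n. induction n as [n IH] using lt_wf_ind. destruct n as [|m].
- unfold inv_coef. simpl. rewrite Rabs_R1. lra.
- rewrite inv_coef_S, Rabs_Ropp.
  apply Rle_trans with (sum_f_R0 (fun k => M ^ S k * (2 * M) ^ (m - k)) m).
  + eapply Rle_trans. apply Rsum_abs. apply sum_Rle. intros k Hk.
    rewrite Rabs_mult. apply Rmult_le_compat; try apply Rabs_pos. apply Ha.
    apply IH. lia.
  + rewrite sum_mixed_powers. pose proof (pow_lt M (S m) HM). lra.
Qed.

Lemma PSeries_inv (a : nat -> R) (M : R) :
  0 < M -> a O = 1 -> (forall n, Rabs (a n) <= M ^ n) ->
  forall t, Rabs t < / (2 * M) -> PSeries a t * PSeries (inv_coef a) t = 1.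
Proof.
intros HM H0 Ha t Ht.
assert (Hlt : / (2 * M) < / M) by (apply Rinv_lt_contravar; nra).
rewrite <- PSeries_mult.
- rewrite (PSeries_ext _ (fun n => match n with O => 1 | _ => 0 end))
    by (intros n; now apply PS_mult_inv_coef).
  apply PSeries_const_coef.
- apply Rbar_lt_le_trans with (/ M). simpl; lra. now apply CV_radius_geometric.
- apply Rbar_lt_le_trans with (/ (2 * M)). exact Ht.
  apply CV_radius_geometric. lra. now apply inv_coef_bound.
Qed.

(** * The binomial series of the degenerate exponential *)

(** The degenerate falling factorial y (y - lambda) ... (y - (n-1) lambda) divided by n!; for lambda
    = 0 it is y^n / n!. *)
Fixpoint binom_coef (lambda y : R) (n : nat) : R :=
  match n with
  | O => 1
  | S k => binom_coef lambda y k * ((y - INR k * lambda) / INR (S k))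
  end.

(** Bounds every ratio (y - k lambda) / (k + 1) in absolute value; the summand 1 keeps it positive
    when y = lambda = 0. *)
Definition binom_bound (lambda y : R) : R := Rabs y + Rabs lambda + 1.

Lemma binom_bound_pos (lambda y : R) : 0 < binom_bound lambda y.
Proof. unfold binom_bound. pose proof (Rabs_pos y). pose proof (Rabs_pos lambda). lra. Qed.

Lemma binom_coef_bound (lambda y : R) (n : nat) :
  Rabs (binom_coef lambda y n) <= binom_bound lambda y ^ n.
Proof.
induction n as [|n IH]. simpl; rewrite Rabs_R1; lra.
cbn [binom_coef pow]. rewrite Rabs_mult, Rmult_comm.
apply Rmult_le_compat; try apply Rabs_pos; [|exact IH].
assert (Hn : 0 <= INR n) by apply pos_INR.
unfold Rdiv. rewrite Rabs_mult, S_INR, (Rabs_pos_eq (/ (INR n + 1)))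
  by (left; apply Rinv_0_lt_compat; lra).
apply Rmult_le_reg_r with (INR n + 1). lra.
rewrite Rmult_assoc, Rinv_l, Rmult_1_r by lra.
eapply Rle_trans. apply Rabs_triang.
rewrite Rabs_Ropp, Rabs_mult, (Rabs_pos_eq (INR n)) by exact Hn.
unfold binom_bound. pose proof (Rabs_pos y). pose proof (Rabs_pos lambda). nra.
Qed.

Lemma binom_CV_radius (lambda y t : R) :
  Rabs t < / binom_bound lambda y ->
  Rbar_lt (Rabs t) (CV_radius (binom_coef lambda y)).
Proof.
intros Ht. apply Rbar_lt_le_trans with (/ binom_bound lambda y). exact Ht.
apply CV_radius_geometric. apply binom_bound_pos. apply binom_coef_bound.
Qed.

Lemma binom_base_pos (lambda y t : R) :
  Rabs t < / binom_bound lambda y -> 0 < 1 + lambda * t.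
Proof.
intros Ht.
assert (H1 : Rabs t * binom_bound lambda y < 1).
{ pose proof (binom_bound_pos lambda y).
  apply Rmult_lt_reg_r with (/ binom_bound lambda y).
  now apply Rinv_0_lt_compat.
  rewrite Rmult_assoc, Rinv_r, Rmult_1_r, Rmult_1_l by lra. exact Ht. }
assert (H2 : Rabs (lambda * t) < 1).
{ rewrite Rabs_mult. unfold binom_bound in H1.
  pose proof (Rabs_pos y). pose proof (Rabs_pos lambda). pose proof (Rabs_pos t). nra. }
apply Rabs_def2 in H2. lra.
Qed.

(** At degree n this is (n+1) c_(n+1) + lambda n c_n = y c_n, the recursion defining
    [binom_coef]. *)
Lemma binom_ode (lambda y t : R) :
  Rabs t < / binom_bound lambda y ->
  (1 + lambda * t) * PSeries (PS_derive (binom_coef lambda y)) t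
  = y * PSeries (binom_coef lambda y) t.
Proof.
intros Ht. set (c := binom_coef lambda y).
assert (Hd : ex_pseries (PS_derive c) t).
{ apply CV_radius_inside. rewrite CV_radius_derive. now apply binom_CV_radius. }
rewrite <- (PSeries_scal y).
rewrite (PSeries_ext (PS_scal y c)
  (PS_plus (PS_derive c) (PS_scal lambda (PS_incr_1 (PS_derive c))))).
- rewrite PSeries_plus; [|exact Hd|].
  + rewrite PSeries_scal, PSeries_incr_1. ring.
  + apply ex_pseries_scal. apply Rmult_comm. now apply ex_pseries_incr_1.
- intros n. unfold PS_scal, PS_plus, PS_derive, PS_incr_1, scal, plus; simpl scal.
  destruct n as [|n]; unfold c; cbn [binom_coef].
  + unfold scal, mult, zero; simpl. unfold mult; simpl. field.
  + unfold scal; simpl. unfold mult; simpl.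
    assert (INR (S n) <> 0) by (apply not_0_INR; lia).
    assert (INR (S (S n)) <> 0) by (apply not_0_INR; lia).
    cbn [INR] in *. field. auto.
Qed.

Lemma deg_exp_plus (lambda y z t : R) :
  deg_exp lambda (y + z) t = deg_exp lambda y t * deg_exp lambda z t.
Proof.
unfold deg_exp. destruct (Req_EM_T lambda 0).
- rewrite <- exp_plus. f_equal. ring.
- rewrite <- Rpower_plus. f_equal. now field.
Qed.

Lemma deg_exp_0_l (lambda t : R) : deg_exp lambda 0 t = 1.
Proof.
unfold deg_exp, Rpower. destruct (Req_EM_T lambda 0).
- rewrite Rmult_0_l. apply exp_0.
- unfold Rdiv. rewrite !Rmult_0_l. apply exp_0.
Qed.

Lemma deg_exp_0_r (lambda y : R) : deg_exp lambda y 0 = 1.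
Proof.
unfold deg_exp, Rpower. destruct (Req_EM_T lambda 0); rewrite Rmult_0_r.
- apply exp_0.
- rewrite Rplus_0_r, ln_1, Rmult_0_r. apply exp_0.
Qed.

Lemma is_derive_deg_exp (lambda y t : R) :
  0 < 1 + lambda * t ->
  is_derive (deg_exp lambda y) t (y / (1 + lambda * t) * deg_exp lambda y t).
Proof.
intros Ht. unfold deg_exp, Rpower. destruct (Req_EM_T lambda 0) as [->|Hl].
- auto_derive. easy. field.
- auto_derive. easy. field. lra.
Qed.

(** By the differential equation, [deg_exp lambda (- y)] times the series has derivative 0, so it
    keeps its value 1 at 0. Multiplying by [deg_exp lambda y] gives the claim, for zero and nonzero
    [lambda] alike. *)
Lemma binom_series (lambda y t : R) :
  Rabs t < / binom_bound lambda y ->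
  PSeries (binom_coef lambda y) t = deg_exp lambda y t.
Proof.
intros Ht. set (c := binom_coef lambda y).
set (P := fun s => deg_exp lambda (- y) s * PSeries c s).
assert (HP : forall s, Rabs s <= Rabs t -> is_derive P s 0).
{ intros s Hs. assert (Hs' : Rabs s < / binom_bound lambda y) by lra.
  assert (Hpos := binom_base_pos lambda y s Hs').
  replace 0 with
    (- y / (1 + lambda * s) * deg_exp lambda (- y) s * PSeries c s
     + deg_exp lambda (- y) s * PSeries (PS_derive c) s).
  - apply (is_derive_mult (deg_exp lambda (- y)) (PSeries c)).
    + now apply is_derive_deg_exp.
    + apply is_derive_PSeries. now apply binom_CV_radius.
    + intros; apply Rmult_comm.
  - assert (Hode := binom_ode lambda y s Hs'). fold c in Hode.
    (* Clearing the denominator exposes the left side of [binom_ode]. *)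
    apply Rmult_eq_reg_l with (1 + lambda * s); [|lra].
    replace ((1 + lambda * s) * _) with
      (deg_exp lambda (- y) s * ((1 + lambda * s) * PSeries (PS_derive c) s
         - y * PSeries c s)) by (field; lra).
    rewrite Hode. ring. }
assert (Hconst : P t = P 0).
(* [eq_is_derive] wants ordered endpoints, hence the split on the sign of [t]. *)
{ destruct (Rtotal_order t 0) as [Hn|[->|Hp]]; [|reflexivity|].
  - apply eq_is_derive; [|exact Hn]. intros s Hs. apply HP.
    rewrite !Rabs_left1 by lra. lra.
  - symmetry. apply eq_is_derive; [|exact Hp]. intros s Hs. apply HP.
    rewrite !Rabs_pos_eq by lra. lra. }
unfold P in Hconst. rewrite deg_exp_0_r, PSeries_0 in Hconst. cbn in Hconst.
rewrite Rmult_1_l in Hconst.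
rewrite <- (Rmult_1_l (PSeries c t)), <- (deg_exp_0_l lambda t).
replace 0 with (y + - y) by ring.
rewrite deg_exp_plus, Rmult_assoc, Hconst. ring.
Qed.

(** * Analyticity of the generating functions *)

Lemma analytic_deg_exp (lambda y : R) : analytic_at_0 (deg_exp lambda y).
Proof.
assert (Hb := binom_bound_pos lambda y).
apply (analytic_of_pseries (binom_coef lambda y) _ (/ binom_bound lambda y)).
- now apply Rinv_0_lt_compat.
- apply CV_radius_geometric. exact Hb. apply binom_coef_bound.
- intros t. apply binom_series.
Qed.

Lemma analytic_inv_two_minus_deg_exp (lambda : R) :
  analytic_at_0 (fun t => / (2 - deg_exp lambda 1 t)).
Proof.
set (c := binom_coef lambda 1). set (M := binom_bound lambda 1).
(* The coefficients of 2 - E_1; the constant term is 2 - 1 = 1, as the inversion requires. *)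
set (a := fun n => match n with O => 1 | S _ => - c n end).
assert (HM : 0 < M) by apply binom_bound_pos.
assert (Ha : forall n, Rabs (a n) <= M ^ n).
{ intros n. assert (Hc := binom_coef_bound lambda 1 n).
  destruct n; cbn [a]; [exact Hc|]. now rewrite Rabs_Ropp. }
assert (Hlt : / (2 * M) < / M) by (apply Rinv_lt_contravar; nra).
apply (analytic_of_pseries (inv_coef a) _ (/ (2 * M))).
- apply Rinv_0_lt_compat. lra.
- apply CV_radius_geometric. lra. now apply inv_coef_bound.
- intros t Ht.
  assert (Hc : PSeries a t = 2 - deg_exp lambda 1 t).
  { assert (Hex : forall b, (forall n, Rabs (b n) <= M ^ n) -> ex_pseries b t).
    { intros b Hb. apply CV_radius_inside. apply Rbar_lt_le_trans with (/ M).
      simpl; lra. now apply CV_radius_geometric. }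
    rewrite <- binom_series by (fold M; lra). fold c.
    rewrite (PSeries_decr_1 a) by now apply Hex.
    rewrite (PSeries_decr_1 c) by (apply Hex, binom_coef_bound).
    rewrite (PSeries_ext (PS_decr_1 a) (PS_opp (PS_decr_1 c))) by reflexivity.
    rewrite PSeries_opp. cbn. ring. }
  assert (H := PSeries_inv a M HM eq_refl Ha t Ht). rewrite Hc in H.
  apply Rmult_eq_reg_l with (2 - deg_exp lambda 1 t).
  + rewrite H. symmetry. apply Rinv_r. intros E. rewrite E in H. lra.
  + intros E. rewrite E in H. lra.
Qed.

(** Continuity at 0, where the value is 1. *)
Lemma two_minus_deg_exp_pos (lambda : R) :
  locally 0 (fun t => 0 < 2 - deg_exp lambda 1 t).
Proof.
assert (Hc : continuous (deg_exp lambda 1) 0).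
{ apply (ex_derive_continuous (deg_exp lambda 1)).
  eexists. apply is_derive_deg_exp. lra. }
assert (H := Hc (fun z => z < 2)). rewrite deg_exp_0_r in H.
assert (H12 : 1 < 2) by lra.
apply (filter_imp (fun t => deg_exp lambda 1 t < 2)); [intros t Ht; lra|].
exact (H (open_lt 2 1 H12)).
Qed.

Lemma Rpower_opp_INR (z : R) (k : nat) : 0 < z -> Rpower z (- INR k) = (/ z) ^ k.
Proof. intros Hz. now rewrite Rpower_Ropp, Rpower_pow, pow_inv. Qed.

Lemma fubini_gen_eq (beta lambda x t : R) :
  fubini_gen beta lambda x t
  = Rpower 2 beta * Rpower (2 - deg_exp lambda 1 t) (- (2 * beta)) * deg_exp lambda x t.
Proof. unfold fubini_gen, Rdiv. now rewrite Rpower_Ropp. Qed.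

(** For natural [alpha] the real power is a natural power of the analytic function 1 / (2 - E_1). *)
Lemma analytic_fubini_gen (alpha : nat) (lambda x : R) :
  analytic_at_0 (fubini_gen (INR alpha) lambda x).
Proof.
apply analytic_ext with (fun t => Rpower 2 (INR alpha)
  * (/ (2 - deg_exp lambda 1 t)) ^ (2 * alpha) * deg_exp lambda x t).
- generalize (two_minus_deg_exp_pos lambda). apply filter_imp. intros t Ht.
  rewrite fubini_gen_eq, <- Rpower_opp_INR, mult_INR by exact Ht. reflexivity.
- apply analytic_mult; [|apply analytic_deg_exp].
  apply analytic_mult; [apply analytic_const|].
  apply analytic_pow, analytic_inv_two_minus_deg_exp.
Qed.

(** Lowering the order by 1/2 removes one factor 2 - E_1 from the denominator and one factor
    [sqrt 2] from the numerator. *)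
Lemma fubini_gen_half_step (beta lambda x t : R) :
  0 < 2 - deg_exp lambda 1 t ->
  sqrt 2 * fubini_gen (beta - 1 / 2) lambda x t
  = (2 - deg_exp lambda 1 t) * fubini_gen beta lambda x t.
Proof.
intros Ht. rewrite !fubini_gen_eq. set (G := 2 - deg_exp lambda 1 t) in *.
replace (- (2 * (beta - 1 / 2))) with (1 + - (2 * beta)) by field.
replace (Rpower 2 beta) with (sqrt 2 * Rpower 2 (beta - 1 / 2)).
- rewrite (Rpower_plus 1), Rpower_1 by exact Ht. ring.
- rewrite <- Rpower_sqrt, <- Rpower_plus by lra. f_equal. field.
Qed.

(** Obtained from order [alpha] through the half step, which also covers [alpha = 0], where the
    order -1/2 is negative. *)
Lemma analytic_fubini_gen_half (alpha : nat) (lambda x : R) :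
  analytic_at_0 (fubini_gen (INR alpha - 1 / 2) lambda x).
Proof.
assert (Hs : sqrt 2 <> 0) by (pose proof (sqrt_lt_R0 2); lra).
apply analytic_ext with (fun t => / sqrt 2 * ((2 + - 1 * deg_exp lambda 1 t)
  * fubini_gen (INR alpha) lambda x t)).
- generalize (two_minus_deg_exp_pos lambda). apply filter_imp. intros t Ht.
  replace (2 + _) with (2 - deg_exp lambda 1 t) by ring.
  rewrite <- fubini_gen_half_step by exact Ht. now field.
- apply analytic_mult; [apply analytic_const|].
  apply analytic_mult; [|apply analytic_fubini_gen].
  apply analytic_plus; [apply analytic_const|].
  apply analytic_mult; [apply analytic_const|apply analytic_deg_exp].
Qed.

(** * Exponential coefficients and their comparison *)

(** Analyticity supplies the existence that [epsilon_spec] needs, once the coefficients are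
    multiplied by n!. *)
Lemma deg_fubini_egf (beta x lambda : R) :
  analytic_at_0 (fubini_gen beta lambda x) ->
  is_egf (fubini_gen beta lambda x) (fun n => deg_fubini n beta x lambda).
Proof.
intros [a Ha]. unfold deg_fubini. apply epsilon_spec.
exists (fun n => a n * INR (fact n)). revert Ha. unfold is_egf. apply filter_imp. intros t.
apply is_pseries_ext. intros n.
change (a n = a n * INR (fact n) / INR (fact n)). field. apply INR_fact_neq_0.
Qed.

(** Identity theorem for power series: both radii are positive and the sums agree near 0. *)
Lemma is_egf_unique (f : R -> R) (a b : nat -> R) :
  is_egf f a -> is_egf f b -> forall n, a n = b n.
Proof.
intros Ha Hb n.
assert (H : a n / INR (fact n) = b n / INR (fact n)).
{ apply (PSeries_ext_recip (fun n => a n / INR (fact n)) (fun n => b n / INR (fact n))).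
  - exact (CV_radius_pos_of_locally _ _ Ha).
  - exact (CV_radius_pos_of_locally _ _ Hb).
  - generalize (filter_and _ _ Ha Hb). apply filter_imp. intros t [H1 H2].
    now rewrite (is_pseries_unique _ _ _ H1), (is_pseries_unique _ _ _ H2). }
apply Rmult_eq_reg_r with (/ INR (fact n)). exact H.
apply Rinv_neq_0_compat, INR_fact_neq_0.
Qed.

Lemma is_egf_lin (f g : R -> R) (a b : nat -> R) (u v : R) :
  is_egf f a -> is_egf g b ->
  is_egf (fun t => u * f t + v * g t) (fun n => u * a n + v * b n).
Proof.
intros Ha Hb. unfold is_egf. generalize (filter_and _ _ Ha Hb). apply filter_imp. intros t [H1 H2].
apply (is_pseries_scal u) in H1; [|apply Rmult_comm].
apply (is_pseries_scal v) in H2; [|apply Rmult_comm].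
refine (is_pseries_ext _ _ _ _ _ (is_pseries_plus _ _ _ _ _ H1 H2)).
intros n.
change (u * (a n / INR (fact n)) + v * (b n / INR (fact n))
  = (u * a n + v * b n) / INR (fact n)).
field. apply INR_fact_neq_0.
Qed.

Theorem theorem3p6 (alpha : nat) (lambda x : R) (n : nat) :
  deg_fubini n (INR alpha) (x + 1) lambda
  = 2 * deg_fubini n (INR alpha) x lambda
    - sqrt 2 * deg_fubini n (INR alpha - 1 / 2) x lambda.
Proof.
assert (H1 := deg_fubini_egf _ (x + 1) lambda (analytic_fubini_gen alpha lambda (x + 1))).
assert (H2 := deg_fubini_egf _ x lambda (analytic_fubini_gen alpha lambda x)).
assert (H3 := deg_fubini_egf _ x lambda (analytic_fubini_gen_half alpha lambda x)).
assert (H4 := is_egf_lin _ _ _ _ 2 (- sqrt 2) H2 H3).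
assert (H5 := is_egf_unique (fubini_gen (INR alpha) lambda (x + 1)) _
  (fun n => 2 * deg_fubini n (INR alpha) x lambda
            + - sqrt 2 * deg_fubini n (INR alpha - 1 / 2) x lambda) H1).
cbv beta in H5. rewrite H5; [ring|].
(* It remains that the combined sequence generates the function at [x + 1]; the functional equation
   is used only where 2 - E_1 is positive. *)
unfold is_egf. generalize (filter_and _ _ H4 (two_minus_deg_exp_pos lambda)).
apply filter_imp. intros t [Hs Ht].
replace (fubini_gen (INR alpha) lambda (x + 1) t) with
  (2 * fubini_gen (INR alpha) lambda x t
   + - sqrt 2 * fubini_gen (INR alpha - 1 / 2) lambda x t); [exact Hs|].
rewrite Ropp_mult_distr_l_reverse, fubini_gen_half_step by exact Ht.
unfold fubini_gen. rewrite deg_exp_plus. ring.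
Qed.
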